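(* Let $n\ge 3$ and let $R$ be a ring with $m$-term Euclidean algorithm for some $1\le m\le n-2$. Let $\sigma\in \mathrm{GL}_n(R)$, let $i,j,k,l\in\{1,\dots,n\}$ with $i\neq j$ and $k\neq l$, and let $a,b,c\in R$. Then (i) $t_{kl}(a\sigma_{ij}b)$ is a product of $8$ $\mathrm{E}_n(R)$-conjugates of $\sigma$ and $\sigma^{-1}$, and (ii) $t_{kl}(a(c\sigma_{ii}-\sigma_{jj}c)b)$ is a product of $24$ $\mathrm{E}_n(R)$-conjugates of $\sigma$ and $\sigma^{-1}$.
   Context: Rings are associative with $1\neq 0$, not necessarily commutative. $R$ is a ring with $m$-term Euclidean algorithm if for any row vector $v$ of length $m$ over $R$ there is a $\tau\in \mathrm{E}_m(R)$ such that $v\tau$ has a zero entry. $\mathrm{GL}_n(R)$ is the group of invertible $n\times n$ matrices over $R$; $\sigma_{ij}$ is the $(i,j)$ entry of $\sigma$. For $i\ne j$ and $x\in R$, $t_{ij}(x)=e+xe^{ij}$, where $e$ is the identity matrix and $e^{ij}$ is the matrix with $1$ at position $(i,j)$ and $0$ elsewhere. For any size $m$, $\mathrm{E}_m(R)$ is the subgroup of $\mathrm{GL}_m(R)$ generated by all $t_{ij}(x)$ ($i\neq j$, $x\in R$). For $g,h$ in a group, $g^h=h^{-1}gh$. ''A product of $N$ $\mathrm{E}_n(R)$-conjugates of $\sigma$ and $\sigma^{-1}$'' means a product of $N$ factors, each of the form $\sigma^{\xi}$ or $(\sigma^{-1})^{\xi}$ with $\xi\in \mathrm{E}_n(R)$.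 *)

(* Defs.v *)
From HB Require Import structures.
From mathcomp Require Import all_boot all_order all_algebra.

Set Implicit Arguments.
Unset Strict Implicit.
Unset Printing Implicit Defensive.

Import GRing.Theory.
Local Open Scope ring_scope.

(* [unitmx] and {'GL_n[R]} are determinant-based and hence restricted to
   commutative R (the latter also to finite R and n > 0).  Over an arbitrary
   ring, an element of GL_n(R) is a matrix packed with its two-sided inverse;
   the equations are boolean so that equality in [GL R n] is equality of the
   underlying matrices ([GL_mx_inj]).  *)
Record GL (R : nzRingType) (n : nat) := MkGL {
  GL_pair : 'M[R]_n * 'M[R]_n;
  GL_axiom : (GL_pair.1 *m GL_pair.2 == 1%:M) && (GL_pair.2 *m GL_pair.1 == 1%:M)
}.

Coercion GL_mx (R : nzRingType) (n : nat) (g : GL R n) : 'M[R]_n := (GL_pair g).1.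

Section GLGroup.
Variables (R : nzRingType) (n : nat).
Implicit Types g h k : GL R n.

HB.instance Definition _ := [isSub for @GL_pair R n].
HB.instance Definition _ := [Choice of GL R n by <:].

Definition GL_inv g : 'M[R]_n := (GL_pair g).2.

Lemma GL_mulmxV g : GL_mx g *m GL_inv g = 1%:M.
Proof. by case/andP: (GL_axiom g) => /eqP. Qed.

Lemma GL_mulVmx g : GL_inv g *m GL_mx g = 1%:M.
Proof. by case/andP: (GL_axiom g) => _ /eqP. Qed.

Lemma GL_mx_inj : injective (@GL_mx R n).
Proof.
move=> g h eq_gh; apply: val_inj => /=.
rewrite [GL_pair g]surjective_pairing [GL_pair h]surjective_pairing.
congr pair; first exact: eq_gh.
rewrite -/(GL_inv g) -/(GL_inv h).
by rewrite -[GL_inv g]mulmx1 -(GL_mulmxV h) -eq_gh mulmxA GL_mulVmx mul1mx.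
Qed.

Lemma GL_one_subproof :
  ((1%:M : 'M[R]_n) *m 1%:M == 1%:M) && ((1%:M : 'M[R]_n) *m 1%:M == 1%:M).
Proof. by rewrite mulmx1 eqxx. Qed.

Definition GL_one : GL R n := @MkGL R n (1%:M, 1%:M) GL_one_subproof.

Lemma GL_invg_subproof g :
  (GL_inv g *m GL_mx g == 1%:M) && (GL_mx g *m GL_inv g == 1%:M).
Proof. by rewrite GL_mulmxV GL_mulVmx eqxx. Qed.

Definition GL_invg g : GL R n :=
  @MkGL R n (GL_inv g, GL_mx g) (GL_invg_subproof g).

Lemma GL_mulg_subproof g h :
  ((GL_mx g *m GL_mx h) *m (GL_inv h *m GL_inv g) == 1%:M) &&
  ((GL_inv h *m GL_inv g) *m (GL_mx g *m GL_mx h) == 1%:M).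
Proof.
rewrite mulmxA -(mulmxA (GL_mx g)) GL_mulmxV mulmx1 GL_mulmxV eqxx /=.
by rewrite mulmxA -(mulmxA (GL_inv h)) GL_mulVmx mulmx1 GL_mulVmx.
Qed.

Definition GL_mulg g h : GL R n :=
  @MkGL R n (GL_mx g *m GL_mx h, GL_inv h *m GL_inv g) (GL_mulg_subproof g h).

Lemma GL_mulgA : associative GL_mulg.
Proof. by move=> g h k; apply: GL_mx_inj; rewrite /GL_mx /= mulmxA. Qed.

Lemma GL_mul1g : left_id GL_one GL_mulg.
Proof. by move=> g; apply: GL_mx_inj; rewrite /GL_mx /= mul1mx. Qed.

Lemma GL_mulg1 : right_id GL_one GL_mulg.
Proof. by move=> g; apply: GL_mx_inj; rewrite /GL_mx /= mulmx1. Qed.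

Lemma GL_mulVg : left_inverse GL_one GL_invg GL_mulg.
Proof. by move=> g; apply: GL_mx_inj; rewrite /GL_mx /= GL_mulVmx. Qed.

Lemma GL_mulgV : right_inverse GL_one GL_invg GL_mulg.
Proof. by move=> g; apply: GL_mx_inj; rewrite /GL_mx /= GL_mulmxV. Qed.

HB.instance Definition _ := isGroup.Build (GL R n)
  GL_mulgA GL_mul1g GL_mulg1 GL_mulVg GL_mulgV.

End GLGroup.

Section Elementary.
Variables (R : nzRingType) (n : nat).

Definition elem_mx (i j : 'I_n) (x : R) : 'M[R]_n := 1%:M + x *: delta_mx i j.

Lemma elem_mx_mulN (i j : 'I_n) (x : R) :
  i != j -> elem_mx i j x *m elem_mx i j (- x) = 1%:M.
Proof.
move=> neq_ij; rewrite /elem_mx mulmxDl mul1mx mulmxDr mulmx1.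
suff -> : (x *: delta_mx i j) *m (- x *: delta_mx i j) = 0 :> 'M[R]_n.
  by rewrite addr0 scaleNr subrK.
apply/matrixP => p q; rewrite !mxE big1 // => r _; rewrite !mxE.
have [-> | _] := eqVneq r j; last by rewrite andbF mulr0 mul0r.
by rewrite [j == i]eq_sym (negPf neq_ij) !mulr0.
Qed.

Lemma elem_GL_subproof (i j : 'I_n) (x : R) : i != j ->
  (elem_mx i j x *m elem_mx i j (- x) == 1%:M) &&
  (elem_mx i j (- x) *m elem_mx i j x == 1%:M).
Proof.
move=> neq_ij; rewrite elem_mx_mulN // eqxx /=.
by rewrite -{2}[x]opprK elem_mx_mulN.
Qed.

Definition elem_GL (i j : 'I_n) (neq_ij : i != j) (x : R) : GL R n :=
  @MkGL R n (elem_mx i j x, elem_mx i j (- x)) (elem_GL_subproof x neq_ij).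

End Elementary.

Inductive generated (G : groupType) (S : G -> Prop) : G -> Prop :=
| gen_mem g : S g -> generated S g
| gen_one : generated S 1%g
| gen_mul g h : generated S g -> generated S h -> generated S (g * h)%g
| gen_inv g : generated S g -> generated S (g^-1)%g.

Definition is_elem (R : nzRingType) (n : nat) (g : GL R n) : Prop :=
  exists (i j : 'I_n) (neq_ij : i != j) (x : R), g = elem_GL neq_ij x.

Definition E (R : nzRingType) (n : nat) : GL R n -> Prop :=
  generated (@is_elem R n).

Definition has_term_euclidean_algorithm (R : nzRingType) (m : nat) : Prop :=
  forall v : 'rV[R]_m, exists2 tau : GL R m, E tau &
    exists j : 'I_m, (v *m tau) 0 j = 0.

Definition is_E_conjugate (R : nzRingType) (n : nat) (sigma g : GL R n) : Prop :=
  exists2 xi : GL R n, E xi & g = (sigma ^ xi)%g \/ g = (sigma^-1 ^ xi)%g.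

Definition is_product_of_E_conjugates (R : nzRingType) (n N : nat)
    (sigma g : GL R n) : Prop :=
  exists2 f : 'I_N -> GL R n, (forall r, is_E_conjugate sigma (f r)) &
    g = (\prod_(r < N) f r)%g.

(* Main.v *)
Require Import Defs.
From mathcomp Require Import all_boot all_order all_algebra.
Local Open Scope ring_scope.

Set Implicit Arguments.
Unset Strict Implicit.
Unset Printing Implicit Defensive.

Import GRing.Theory.

(** Suppose that row [i] of [sigma] vanishes in some column [p] different from
   [i].  Then [g = e + sigma e^{pi} z] is a product of elementary matrices in
   column [i], and the conjugate [B = sigma^-1 g sigma = e + z e^{pi} sigma] is
   a transvection that adds [z] times row [i] of [sigma] to [e_p].  A commutator
   of [B] with [t = t_{ji}(y)] reads off one entry of that row: it is
   [t_{pi}(- z sigma_{ij} y)].  The element [B] itself need not be a short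
   product of conjugates of [sigma^{+-1}], but [C = B g^-1 = [sigma, g^-1]] is
   a product of two of them; and as [g] commutes with [t] and with [t_{pi}],
   the commutator of [C] with [t] is the same as that of [B] with [t].  So
   [t_{pi}(a sigma_{ij} b)] is a product of four conjugates
   ([zero_entry_extraction]).

   The Euclidean algorithm provides the vanishing entry.  Choose [m] of the
   [n - 2] indices other than [i] and [j] and conjugate [sigma] by the image in
   E_n of an element of E_m ([E_embed]): this multiplies the corresponding part
   of row [i] by that element and leaves the rest of the row, in particular the
   entry [ij], unchanged ([exists_conjugate_zero_entry]).  Signed permutation
   matrices in E_n then move [t_{pi}] to any position [t_{kl}]
   ([elem_GL_transport]), and the product is filled up to eight factors with
   pairs [sigma sigma^-1].

   The second assertion follows from the first, because for
   [tau = sigma ^ t_{ji}(c)] the element [c sigma_{ii} - sigma_{jj} c] is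
   [sigma_{ji} - tau_{ji} - c sigma_{ij} c], a sum of three terms of the kind
   covered by the first assertion. *)

(** * Products of conjugates *)

Section Products.
Variables (R : nzRingType) (n : nat).
Implicit Types (sigma g h xi : GL R n).

Lemma product_of_conjugatesM N1 N2 sigma g h :
  is_product_of_E_conjugates N1 sigma g ->
  is_product_of_E_conjugates N2 sigma h ->
  is_product_of_E_conjugates (N1 + N2) sigma (g * h)%g.
Proof.
move=> [f1 Hf1 ->] [f2 Hf2 ->].
exists (fun r => match split r with inl a => f1 a | inr b => f2 b end).
  by move=> r; case: (split r).
rewrite big_split_ord /=; congr (_ * _)%g; apply: eq_bigr => r _.
  by rewrite (unsplitK (inl r)).
by rewrite (unsplitK (inr r)).
Qed.

Lemma product_of_conjugates1 sigma g :
  is_E_conjugate sigma g -> is_product_of_E_conjugates 1 sigma g.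
Proof. by move=> Hg; exists (fun=> g); rewrite ?big_ord1. Qed.

Lemma E_conjugateJ sigma g xi :
  E xi -> is_E_conjugate sigma g -> is_E_conjugate sigma (g ^ xi)%g.
Proof.
move=> Exi [eta Eeta Hg]; exists (eta * xi)%g; first exact: gen_mul.
by case: Hg => ->; [left | right]; rewrite conjgM.
Qed.

Lemma product_of_conjugatesJ N sigma g xi :
  E xi -> is_product_of_E_conjugates N sigma g ->
  is_product_of_E_conjugates N sigma (g ^ xi)%g.
Proof.
move=> Exi [f Hf ->]; exists (fun r => (f r ^ xi)%g).
  by move=> r; apply: E_conjugateJ.
exact: conjg_prod.
Qed.

Lemma product_of_conjugates_base N sigma xi g :
  E xi -> is_product_of_E_conjugates N (sigma ^ xi)%g g ->
  is_product_of_E_conjugates N sigma g.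
Proof.
move=> Exi [f Hf ->]; exists f => // r.
have [eta Eeta Hr] := Hf r; exists (xi * eta)%g; first exact: gen_mul.
by case: Hr => ->; [left | right]; rewrite ?conjVg conjgM.
Qed.

Lemma E_conjugate_refl sigma : is_E_conjugate sigma sigma.
Proof. by exists 1%g; [exact: gen_one | left; rewrite conjg1]. Qed.

Lemma E_conjugate_inv sigma : is_E_conjugate sigma (sigma^-1)%g.
Proof. by exists 1%g; [exact: gen_one | right; rewrite conjg1]. Qed.

Lemma product_of_conjugates_pad2 N sigma g :
  is_product_of_E_conjugates N sigma g ->
  is_product_of_E_conjugates (N + 2) sigma g.
Proof.
move=> Hg; rewrite -[g]mulg1 -(mulgV sigma).
apply: product_of_conjugatesM => //; rewrite -[2%N]/(1 + 1)%N.
by apply: product_of_conjugatesM; apply: product_of_conjugates1;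
  [exact: E_conjugate_refl | exact: E_conjugate_inv].
Qed.

(** The count is [2 + 2]: with [C = sigma^-1 sigma^h] also its inverse
   [(sigma^-1)^h sigma] is a product of two conjugates. *)
Lemma product_of_conjugates_double_commutator sigma h t : E h -> E t ->
  let C := (sigma^-1 * sigma ^ h)%g in
  is_product_of_E_conjugates 4 sigma (C^-1 * C ^ t)%g.
Proof.
move=> Eh Et C; rewrite -[4%N]/(2 + 2)%N -[2%N]/(1 + 1)%N.
apply: product_of_conjugatesM; last apply: product_of_conjugatesJ => //.
  rewrite invgM invgK -conjVg; apply: product_of_conjugatesM;
    apply: product_of_conjugates1; last exact: E_conjugate_refl.
  exact/E_conjugateJ/E_conjugate_inv.
apply: product_of_conjugatesM; apply: product_of_conjugates1.
  exact: E_conjugate_inv.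
exact/E_conjugateJ/E_conjugate_refl.
Qed.

End Products.

(** * Elementary matrices *)

Section ElementaryMatrices.
Variables (R : nzRingType) (n : nat).
Implicit Types (S : 'M[R]_n) (i j k l p q : 'I_n) (a b c x y z : R).

Lemma GL_mxM (g h : GL R n) : GL_mx (g * h)%g = GL_mx g *m GL_mx h.
Proof. by []. Qed.

Lemma GL_mulmxK (r : nat) (A : 'M[R]_(r, n)) (g : GL R n) :
  A *m GL_mx g *m GL_mx g^-1%g = A.
Proof. by rewrite -mulmxA [X in _ *m X]GL_mulmxV mulmx1. Qed.

Lemma GL_mulmxKV (r : nat) (A : 'M[R]_(r, n)) (g : GL R n) :
  A *m GL_mx g^-1%g *m GL_mx g = A.
Proof. by rewrite -mulmxA [X in _ *m X]GL_mulVmx mulmx1. Qed.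

Lemma GL_mx_elem i j (neq_ij : i != j) x :
  GL_mx (elem_GL neq_ij x) = 1%:M + x *: delta_mx i j.
Proof. by []. Qed.

Lemma E_elem i j (neq_ij : i != j) x : E (elem_GL neq_ij x).
Proof. by apply: gen_mem; exists i, j, neq_ij, x. Qed.

Lemma delta_scale_mulmx S i j p l a b :
  (a *: delta_mx p i) *m S *m (b *: delta_mx j l) = (a * S i j * b) *: delta_mx p l.
Proof.
apply/matrixP => r s; rewrite !mxE (bigD1 j) //= big1 => [|u neq_uj]; last first.
  by rewrite !mxE (negPf neq_uj) mulr0 mulr0.
rewrite !mxE (bigD1 i) //= big1 => [|u neq_ui]; last first.
  by rewrite !mxE (negPf neq_ui) andbF mulr0 mul0r.
rewrite !mxE !eqxx addr0 addr0 /= andbT.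
by case: (r == p); case: (s == l); rewrite /= ?mulr1 ?mulr0 ?mul0r ?mulrA.
Qed.

Lemma delta_scale_mul i j p l a b :
  (a *: delta_mx p i) *m (b *: delta_mx j l) =
  (a * (i == j)%:R * b) *: delta_mx p l :> 'M[R]_n.
Proof. by rewrite -[X in X *m _]mulmx1 delta_scale_mulmx mxE. Qed.

Lemma elem_GLD i j (neq_ij : i != j) x y :
  elem_GL neq_ij (x + y) = (elem_GL neq_ij x * elem_GL neq_ij y)%g.
Proof.
apply: GL_mx_inj; rewrite GL_mxM !GL_mx_elem mulmxDl mul1mx mulmxDr mulmx1.
rewrite delta_scale_mul eq_sym (negPf neq_ij) mulr0 mul0r scale0r addr0.
by rewrite scalerDl addrA addrAC.
Qed.

(** As [u i = 0], the matrices [u r *: delta_mx r i] annihilate each other, and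
   the product of the [1 + u r *: delta_mx r i] is one plus their sum. *)
Lemma exists_column_transvection i (u : 'I_n -> R) : u i = 0 ->
  exists2 g : GL R n, E g & GL_mx g = 1%:M + \sum_r u r *: delta_mx r i.
Proof.
move=> ui0; elim: (index_enum _) => [|r s [g Eg Hg]].
  by exists 1%g; [exact: gen_one | rewrite big_nil addr0].
rewrite big_cons; have [-> | neq_ri] := eqVneq r i.
  by exists g; rewrite // ui0 scale0r add0r.
exists (elem_GL neq_ri (u r) * g)%g; first by apply: gen_mul => //; exact: E_elem.
rewrite GL_mxM GL_mx_elem Hg mulmxDr mulmx1 mulmxDl mul1mx.
rewrite mulmx_sumr [X in _ + (_ + X)]big1 => [|q _]; first by rewrite addr0 addrA.
rewrite delta_scale_mul; have [<- | _] := eqVneq i q.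
  by rewrite ui0 mulr0 scale0r.
by rewrite mulr0 mul0r scale0r.
Qed.

(** * Extracting an entry next to a zero *)

(** This is the commutator computation with [z = - a] and [y = b]: conjugation
   by [sigma] turns a column transvection [g] into a row transvection [B]
   that carries row [i] of [sigma]. *)
Lemma zero_entry_extraction (sigma : GL R n) i j p (neq_pi : p != i) a b :
  i != j -> sigma i p = 0 ->
  is_product_of_E_conjugates 4 sigma (elem_GL neq_pi (a * sigma i j * b)).
Proof.
move=> neq_ij sip0; have neq_ip : i != p by rewrite eq_sym.
have neq_ji : j != i by rewrite eq_sym.
pose S := GL_mx sigma; pose X : 'M[R]_n := (- a) *: delta_mx p i.
have [g Eg Hg] : exists2 g : GL R n, E g & GL_mx g = 1%:M + S *m X.
  have [|g Eg Hg] := @exists_column_transvection i (fun r => S r p * - a).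
    by rewrite [S i p]sip0 mul0r.
  exists g => //; rewrite Hg; congr (_ + _); apply/matrixP => r s.
  rewrite summxE (bigD1 r) //= big1 => [|q neq_qr]; last first.
    by rewrite !mxE eq_sym (negPf neq_qr) mulr0.
  rewrite !mxE (bigD1 p) //= big1 => [|q neq_qp]; last first.
    by rewrite !mxE (negPf neq_qp) !mulr0.
  by rewrite !mxE !eqxx /= !addr0 mulrA.
set x := a * _ * b; pose t' := elem_GL neq_pi x; pose t := elem_GL neq_ji b.
have VS : GL_mx sigma^-1%g *m S = 1%:M := GL_mulVmx sigma.
have [B defB HB] : exists2 B,
    B = (sigma^-1 * g * sigma)%g & GL_mx B = 1%:M + X *m S.
  exists (sigma^-1 * g * sigma)%g => //.
  rewrite !GL_mxM Hg mulmxDr mulmx1 mulmxA.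
  by rewrite VS mul1mx mulmxDl VS.
(* [t' = B^-1 t B t^-1]: row [i] of [B] is that of the identity, and among the
   entries in row [p] of [B] the commutator sees only that in column [j]. *)
have tB : (t * B = B * t' * t)%g.
  apply: GL_mx_inj; rewrite !GL_mxM HB !GL_mx_elem.
  set Y := b *: _; set Z := x *: _.
  have YX : Y *m X = 0.
    by rewrite delta_scale_mul (negPf neq_ip) mulr0 mul0r scale0r.
  have ZY : Z *m Y = 0.
    by rewrite delta_scale_mul (negPf neq_ij) mulr0 mul0r scale0r.
  have XSZ : X *m S *m Z = 0.
    by rewrite delta_scale_mulmx [S i p]sip0 mulr0 mul0r scale0r.
  have XSY : X *m S *m Y = - Z.
    by rewrite delta_scale_mulmx -scaleNr /x !mulNr.
  rewrite -[(1%:M + X *m S) *m _ *m _]mulmxA.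
  rewrite !(mulmxDl, mulmxDr) !mul1mx !mulmx1 ZY XSZ XSY mulmxA YX mul0mx.
  rewrite !mulmx0 !add0r !addr0.
  by rewrite [X *m S - Z]addrC [RHS]addrA addrK addrAC.
have gT q (neq_qi : q != i) y : commute g (elem_GL neq_qi y).
  apply: GL_mx_inj; rewrite !GL_mxM Hg GL_mx_elem.
  rewrite !(mulmxDl, mulmxDr) !mul1mx !mulmx1 -mulmxA delta_scale_mul mulmxA.
  rewrite [i == q]eq_sym (negPf neq_qi) delta_scale_mulmx [S i p]sip0.
  rewrite !mulr0 !mul0r !scale0r mulmx0 !addr0 -!addrA.
  by congr (_ + _); rewrite addrC.
(* [B] may be replaced by [C = B g^-1], since [g] commutes with [t] and [t']. *)
pose C := (sigma^-1 * sigma ^ g^-1)%g.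
have defC : C = (B * g^-1)%g by rewrite /C conjgE invgK defB !mulgA.
have tC : (t * C = C * (t' * t))%g.
  have gtt : commute g^-1%g (t' * t)%g.
    by apply/commute_sym/commuteV/commute_sym/commuteM; apply: gT.
  by rewrite defC mulgA tB -!mulgA gtt !mulgA.
suff -> : elem_GL neq_pi x = (C^-1 * C ^ t^-1)%g.
  apply: product_of_conjugates_double_commutator; apply: gen_inv => //.
  exact: E_elem.
clear defC; clearbody C.
by rewrite conjgE invgK (mulgA t) tC -!mulgA mulKg mulgV mulg1.
Qed.

(** * Moving an elementary matrix to another position *)

Lemma elem_GL_conj (xi : GL R n) p i k l (neq_pi : p != i) (neq_kl : k != l) x :
  (forall r, GL_mx xi r k = (r == p)%:R) ->
  (forall s, GL_mx xi i s = (s == l)%:R) ->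
  (elem_GL neq_pi x ^ xi)%g = elem_GL neq_kl x.
Proof.
move=> col_k row_i; rewrite conjgE; apply: (mulgI xi); rewrite !mulgA mulgV mul1g.
apply: GL_mx_inj; rewrite !GL_mxM !GL_mx_elem mulmxDl mulmxDr mul1mx mulmx1.
congr (_ + _); apply/matrixP => r s.
rewrite !mxE (bigD1 i) //= big1 => [|u neq_ui]; last first.
  by rewrite !mxE (negPf neq_ui) andbF mulr0 mul0r.
rewrite [RHS](bigD1 k) //= big1 => [|u neq_uk]; last first.
  by rewrite !mxE (negPf neq_uk) /= !mulr0.
rewrite !mxE col_k row_i !eqxx !addr0 andbT /=.
by case: (r == p); case: (s == l); rewrite /= ?mulr1 ?mulr0 ?mul0r ?mul1r.
Qed.

Lemma exists_signed_transposition p q : p != q ->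
  exists2 w : GL R n, E w &
    GL_mx w = 1%:M - delta_mx p p - delta_mx q q + delta_mx q p - delta_mx p q.
Proof.
move=> neq_pq; have neq_qp : q != p by rewrite eq_sym.
(* [e^p], multiplied by the three factors from the right, becomes [e^p], then
   [e^p + e^q] and at last [e^q]. *)
exists (elem_GL neq_pq (- 1) * elem_GL neq_qp 1 * elem_GL neq_pq (- 1))%g.
  by apply: gen_mul; last exact: E_elem; apply: gen_mul; exact: E_elem.
rewrite !GL_mxM !GL_mx_elem !scaleN1r scale1r.
rewrite !(mulmxDl, mulmxDr, mulmxN, mulNmx, mul_delta_mx_cond, mulmx1, mul1mx).
rewrite !eqxx ?(negPf neq_pq) ?(negPf neq_qp) !mulr1n ?mulr0n ?mul0mx ?oppr0 ?addr0.
rewrite opprK mul_delta_mx add0r [- _ - delta_mx q q]addrC subrK.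
by rewrite !addrA [LHS](AC (5) (1*4*5*2*3)).
Qed.

(** A signed transposition satisfies [w e^p = e^q] and [e_q w = e_p], with the
   sign [-1] only in [w e^q = - e^p]; conjugation by [w] therefore changes one
   index of [t_{pi}(x)] without changing the sign of [x]. *)
Lemma elem_GL_transport p i k l (neq_pi : p != i) (neq_kl : k != l) x :
  (2 < n)%N ->
  exists2 xi : GL R n, E xi & (elem_GL neq_pi x ^ xi)%g = elem_GL neq_kl x.
Proof.
move=> lt2n.
have move_col p' i' l' (neq_pi' : p' != i') (neq_pl' : p' != l') :
    exists2 xi : GL R n, E xi & (elem_GL neq_pi' x ^ xi)%g = elem_GL neq_pl' x.
  have [eq_li | neq_li] := eqVneq l' i'.
    subst l'; rewrite (bool_irrelevance neq_pl' neq_pi').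
    by exists 1%g; [exact: gen_one | rewrite conjg1].
  have [w Ew Hw] := exists_signed_transposition neq_li.
  exists w => //; apply: elem_GL_conj => r; rewrite Hw !mxE.
    by rewrite (negPf neq_pi') (negPf neq_pl') !andbF !subr0 addr0.
  rewrite !eqxx [i' == l']eq_sym (negPf neq_li) [i' == r]eq_sym /=.
  by rewrite !subr0 subrr add0r.
have move_row p' k' i' (neq_pi' : p' != i') (neq_ki' : k' != i') :
    exists2 xi : GL R n, E xi & (elem_GL neq_pi' x ^ xi)%g = elem_GL neq_ki' x.
  have [eq_kp | neq_kp] := eqVneq k' p'.
    subst k'; rewrite (bool_irrelevance neq_ki' neq_pi').
    by exists 1%g; [exact: gen_one | rewrite conjg1].
  have [w Ew Hw] := exists_signed_transposition neq_kp.
  exists w => //; apply: elem_GL_conj => r; rewrite Hw !mxE.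
    by rewrite !eqxx (negPf neq_kp) !andbT !andbF !subr0 subrr add0r.
  rewrite ![i' == _]eq_sym (negPf neq_ki') (negPf neq_pi') !subr0 addr0.
  by rewrite eq_sym.
have trans (A B C : GL R n) :
    (exists2 xi : GL R n, E xi & (A ^ xi)%g = B) ->
    (exists2 xi : GL R n, E xi & (B ^ xi)%g = C) ->
    exists2 xi : GL R n, E xi & (A ^ xi)%g = C.
  move=> [xi Exi <-] [eta Eeta <-]; exists (xi * eta)%g; first exact: gen_mul.
  by rewrite conjgM.
have avoid (u v : 'I_n) : exists2 q : 'I_n, q != u & q != v.
  have /card_gt0P[q] : (0 < #|~: [set u; v]|)%N.
    rewrite cardsCs setCK card_ord subn_gt0 cards2.
    by apply: leq_ltn_trans lt2n; case: (u != v).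
  by rewrite !inE negb_or => /andP[]; exists q.
(* Moving directly to row k fails if k = i; a detour through a column q that
   differs from both rows p and k always works, and needs three indices. *)
have [q neq_qp neq_qk] := avoid p k.
have neq_pq : p != q by rewrite eq_sym.
have neq_kq : k != q by rewrite eq_sym.
apply: (trans _ _ _ (move_col _ _ _ neq_pi neq_pq)).
apply: (trans _ _ _ (move_row _ _ _ neq_pq neq_kq)).
exact: move_col.
Qed.

End ElementaryMatrices.

(** * Producing a zero entry *)

(** Along [f], the group E_m acts on the coordinates in the image of [f] and
   trivially on the others.  All three properties are about the action on row
   vectors because in that form they pass to products and inverses; a
   generator [t_{ab}(x)] is lifted to [t_{f a, f b}(x)]. *)
Lemma E_embed (R : nzRingType) (n m : nat) (f : 'I_m -> 'I_n) (tau : GL R m) :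
  injective f -> E tau ->
  exists2 xi : GL R n, E xi &
    [/\ forall v : 'rV_n, colsub f (v *m GL_mx xi) = colsub f v *m GL_mx tau,
        forall (v : 'rV_n) s, (forall a, f a != s) -> (v *m GL_mx xi) 0 s = v 0 s
      & forall i, (forall a, f a != i) ->
          delta_mx 0 i *m GL_mx xi = delta_mx 0 i :> 'rV_n].
Proof.
move=> inj_f; elim=> {tau} [_ [i [j [neq_ij [x ->]]]] | |
    g h _ [xi Exi [xi1 xi2 xi3]] _ [eta Eeta [eta1 eta2 eta3]] |
    g _ [xi Exi [xi1 xi2 xi3]]].
- have neq_f : f i != f j by rewrite (inj_eq inj_f).
  have mulE q (u v : 'I_q) (y : 'rV_q) s :
      (y *m (1%:M + x *: delta_mx u v)) 0 s = y 0 s + y 0 u * x * (s == v)%:R.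
    rewrite mulmxDr mulmx1 !mxE (bigD1 u) //= big1 => [|r neq_ru]; last first.
      by rewrite !mxE (negPf neq_ru) !mulr0.
    by rewrite !mxE eqxx addr0 mulrA.
  exists (elem_GL neq_f x); [exact: E_elem | split=> [v | v s fNs | r fNr]].
  + apply/rowP => s; rewrite !GL_mx_elem mxE !mulE !mxE.
    by rewrite (inj_eq inj_f).
  + by rewrite GL_mx_elem mulE eq_sym (negPf (fNs j)) mulr0 addr0.
  + apply/rowP => s; rewrite GL_mx_elem mulE !mxE.
    by rewrite (negPf (fNr i)) mul0r mul0r addr0.
- by exists 1%g; [exact: gen_one | split=> *; rewrite !mulmx1].
- exists (xi * eta)%g; first exact: gen_mul.
  split=> [v | v s fNs | r fNr]; rewrite !GL_mxM mulmxA.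
  + by rewrite eta1 xi1 mulmxA.
  + by rewrite eta2 ?xi2.
  + by rewrite xi3 ?eta3.
- exists (xi^-1)%g; first exact: gen_inv.
  split=> [v | v s fNs | r fNr].
  + by rewrite -[in RHS](GL_mulmxKV v xi) xi1 GL_mulmxK.
  + by rewrite -[in RHS](GL_mulmxKV v xi) xi2.
  + by rewrite -[in LHS](xi3 r fNr) GL_mulmxK.
Qed.

(** The lift [xi] of an element of E_m fixes [e_i], so that row [i] of
   [xi^-1 sigma xi] is just row [i] of [sigma] times [xi]. *)
Lemma exists_conjugate_zero_entry (R : nzRingType) (n m : nat)
    (sigma : GL R n) (i j : 'I_n) :
  (m <= n - 2)%N -> has_term_euclidean_algorithm R m -> i != j ->
  exists2 xi : GL R n, E xi &
    exists2 p, p != i &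
      (GL_mx (sigma ^ xi)%g i p = 0) /\ (GL_mx (sigma ^ xi)%g i j = sigma i j).
Proof.
move=> le_m hR neq_ij; pose A := ~: [set i; j].
have cardA : (m <= #|A|)%N by rewrite cardsCs setCK card_ord cards2 neq_ij.
pose f a := enum_val (widen_ord cardA a).
have inj_f : injective f.
  by move=> a b /enum_val_inj /(congr1 val) /= eq_ab; apply: val_inj.
have fNi a : f a != i.
  by have := enum_valP (widen_ord cardA a); rewrite !inE negb_or => /andP[].
have fNj a : f a != j.
  by have := enum_valP (widen_ord cardA a); rewrite !inE negb_or => /andP[].
have [tau Etau [a tau0]] := hR (colsub f (row i sigma)).
have [xi Exi [xi1 xi2 xi3]] := E_embed inj_f Etau.
have rowE s : GL_mx (sigma ^ xi)%g i s = (row i sigma *m GL_mx xi) 0 s.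
  transitivity (row i (GL_mx (sigma ^ xi)%g) 0 s); first by rewrite [RHS]mxE.
  rewrite conjgE !GL_mxM mulmxA !rowE mulmxA mulmxA.
  by rewrite -{1}(xi3 i fNi) GL_mulmxK.
exists xi => //; exists (f a) => //; split.
  by rewrite rowE -tau0 -xi1 [RHS]mxE.
by rewrite rowE xi2 // mxE.
Qed.

(** * The entries of sigma *)

Lemma elem_GL_entry_product (R : nzRingType) (n m : nat) (sigma : GL R n)
    (i j k l : 'I_n) (neq_ij : i != j) (neq_kl : k != l) (a b : R) :
  (3 <= n)%N -> (m <= n - 2)%N -> has_term_euclidean_algorithm R m ->
  is_product_of_E_conjugates 8 sigma (elem_GL neq_kl (a * sigma i j * b)).
Proof.
move=> le3n le_m hR.
have [xi Exi [p neq_pi [zero_p <-]]] :=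
  exists_conjugate_zero_entry sigma le_m hR neq_ij.
apply: (product_of_conjugates_base Exi).
have [eta Eeta <-] := elem_GL_transport neq_pi neq_kl
  (a * GL_mx (sigma ^ xi)%g i j * b) le3n.
apply: product_of_conjugatesJ => //; rewrite -[8%N]/(4 + 2 + 2)%N.
by do 2!apply: product_of_conjugates_pad2; apply: zero_entry_extraction.
Qed.

Theorem theorem21 (R : nzRingType) (n m : nat) (hn : (3 <= n)%N)
    (hm : (1 <= m <= n - 2)%N) (hR : has_term_euclidean_algorithm R m)
    (sigma : GL R n) (i j k l : 'I_n) (neq_ij : i != j) (neq_kl : k != l)
    (a b c : R) :
  is_product_of_E_conjugates 8 sigma (elem_GL neq_kl (a * sigma i j * b)) /\
  is_product_of_E_conjugates 24 sigma
    (elem_GL neq_kl (a * (c * sigma i i - sigma j j * c) * b)).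
Proof.
have [_ le_m] := andP hm.
split; first exact: elem_GL_entry_product hR.
have neq_ji : j != i by rewrite eq_sym.
pose tau := (sigma ^ elem_GL neq_ji c)%g.
have tauE : GL_mx tau j i =
    sigma j i + sigma j j * c - c * sigma i i - c * sigma i j * c.
  rewrite !GL_mxM GL_mx_elem mulmxA.
  have -> : GL_mx (elem_GL neq_ji c)^-1%g = 1%:M + (- c) *: delta_mx j i by [].
  set S := GL_mx sigma; rewrite mulmxDr mulmx1 mulmxDl mul1mx mulmxDl.
  have rowj : ((- c) *: delta_mx j i *m S) j i = - (c * S i i).
    rewrite mxE (bigD1 i) //= big1 => [|r neq_ri].
      by rewrite !mxE !eqxx mulr1 addr0 mulNr.
    by rewrite !mxE (negPf neq_ri) andbF mulr0 mul0r.
  have coli : (S *m (c *: delta_mx j i)) j i = S j j * c.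
    rewrite mxE (bigD1 j) //= big1 => [|r neq_rj].
      by rewrite !mxE !eqxx mulr1 addr0.
    by rewrite !mxE (negPf neq_rj) !mulr0.
  rewrite delta_scale_mulmx mxE [in LHS]mxE rowj mxE coli !mxE !eqxx mulr1.
  by rewrite addrA [_ - _ + _]addrAC !mulNr.
have -> : c * sigma i i - sigma j j * c =
    sigma j i - GL_mx tau j i - c * sigma i j * c.
  rewrite tauE !opprD !opprK !addrA subrr add0r addrK.
  by rewrite addrC.
rewrite !(mulrBr, mulrBl) -!mulNr !mulrA !elem_GLD -[24%N]/(8 + 8 + 8)%N.
apply: product_of_conjugatesM; first apply: product_of_conjugatesM.
- exact: elem_GL_entry_product hR.
- apply: (product_of_conjugates_base (E_elem neq_ji c)).
  exact: elem_GL_entry_product hR.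
- rewrite -mulrA.
  exact: elem_GL_entry_product hR.
Qed.
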